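(* Let $T_1$ and $T_2$ be finite trees such that $P_3(T_1)$ is isomorphic to $P_3(T_2)$ and this graph is not a complete graph. Then $T_1$ is isomorphic to $T_2$. That is, a tree is uniquely determined (up to isomorphism) by its third power, provided the third power is not complete.
   Context: For a graph $G$, its third power (cube) $P_3(G)$ is the graph on the same vertex set in which two distinct vertices are adjacent if and only if their distance in $G$ is at most $3$. *)

(* Defs.v *)
From mathcomp Require Import all_boot.

Set Implicit Arguments.
Unset Strict Implicit.
Unset Printing Implicit Defensive.

(* Finite simple graphs. *)
Record sgraph := SGraph {
  vertex :> finType;
  adj : rel vertex;
  adj_sym : symmetric adj;
  adj_irr : irreflexive adj }.

Definition connected (G : sgraph) : Prop :=
  0 < #|G| /\ forall x y : G, connect (@adj G) x y.

(* ucycle also accepts an edge traversed back and forth (size 2), which is not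
   a cycle of a simple graph; irreflexivity rules out size 1. *)
Definition acyclic (G : sgraph) : Prop :=
  forall p : seq G, ucycle (@adj G) p -> size p <= 2.

Definition tree (G : sgraph) : Prop := connected G /\ acyclic G.

Definition isomorphic (G H : sgraph) : Prop :=
  exists2 f : G -> H, bijective f & {mono f : x y / adj x y}.

Definition complete (G : sgraph) : Prop :=
  forall x y : G, x != y -> adj x y.

Definition has_walk (G : sgraph) (x y : G) (n : nat) : bool :=
  [exists p : n.-tuple G, path (@adj G) x p && (last x p == y)].

(* The least length of a walk from x to y. Between vertices of different
   components this is the junk value #|G|, so gdist is only meaningful
   together with connect. *)
Definition gdist (G : sgraph) (x y : G) : nat :=
  find (has_walk x y) (iota 0 #|G|).

Definition power_adj (k : nat) (G : sgraph) : rel G :=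
  fun x y => [&& x != y, connect (@adj G) x y & gdist x y <= k].

Lemma has_walk_sym (G : sgraph) (x y : G) (n : nat) :
  has_walk x y n = has_walk y x n.
Proof.
have imp (u v : G) : has_walk u v n -> has_walk v u n.
  case/existsP => p /andP[pP /eqP lP]; apply/existsP.
  have sz : size (rev (belast u p)) == n by rewrite size_rev size_belast size_tuple.
  exists (Tuple sz); rewrite /= -lP rev_path.
  rewrite (eq_path (e' := @adj G)); last by move=> a b; rewrite adj_sym.
  rewrite pP /=; case: (tval p) => //= a q.
  by rewrite rev_cons last_rcons.
by apply/idP/idP; apply: imp.
Qed.

Lemma power_adj_sym (k : nat) (G : sgraph) : symmetric (@power_adj k G).
Proof.
move=> x y; rewrite /power_adj eq_sym.
rewrite (sym_connect_sym (@adj_sym G)) /gdist.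
by rewrite (eq_find (has_walk_sym x y)).
Qed.

Lemma power_adj_irr (k : nat) (G : sgraph) : irreflexive (@power_adj k G).
Proof. by move=> x; rewrite /power_adj eqxx. Qed.

Definition power (k : nat) (G : sgraph) : sgraph :=
  SGraph (@power_adj_sym k G) (@power_adj_irr k G).

(* Main.v *)
Require Import Defs.
From mathcomp Require Import all_boot zify.

Set Implicit Arguments.
Unset Strict Implicit.
Unset Printing Implicit Defensive.

(** Let d be the distance of a tree T of diameter at least 4, and write N(x)
   for the closed neighbourhood of x in the cube of T. Call a non-leaf v deep
   if it is the midpoint of a path of length 4, and shallow otherwise; a shallow
   vertex has exactly one non-leaf neighbour, which is deep. The balls of radius
   1 around deep vertices are exactly the sets N(x) :&: N(y) with at least three
   elements, x and y being non-adjacent in the cube. The balls of radius 2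
   around shallow vertices are exactly the cliques of the form N(x), and then x is a
   leaf attached to that shallow vertex. So the non-leaves of T are labelled by
   sets read off the cube, the labels determine adjacency between non-leaves,
   and counting determines how many leaves are attached to each of them.

   Distances in trees are handled through the four-point condition and the
   parity of d(x,y) + d(y,z) + d(x,z), which reduce configurations of a few
   vertices to linear arithmetic. *)

(** Abstracting from the graph lets two trees with the same cube be compared as two metrics on one
    vertex set. *)
Record tree_metric (V : finType) (d : V -> V -> nat) : Prop := TreeMetric {
  tm_eq0 : forall x y, (d x y == 0) = (x == y);
  tm_sym : forall x y, d x y = d y x;
  tm_tri : forall x y z, d x z <= d x y + d y z;
  tm_even : forall x y z, ~~ odd (d x y + d y z + d x z);
  tm_step : forall x y, x != y -> exists2 z, d x z = 1 & (d z y).+1 = d x y;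
  tm_four : forall x y z w,
    d x y + d z w <= maxn (d x z + d y w) (d x w + d y z) }.

(** * Distance as the length of a shortest path *)

Section GraphDistance.

Variable G : sgraph.
Implicit Types x y z : G.

Lemma gdist_path x p : path (@adj G) x p -> gdist x (last x p) <= size p.
Proof.
move=> xp; case: (shortenP xp) => q xq uq sqp.
apply: leq_trans (_ : size q <= _); last first.
  by apply: uniq_leq_size => //; case/andP: uq.
have lt_q : size q < #|G|.
  by have := max_card (mem (x :: q)); rewrite (card_uniqP uq).
rewrite leqNgt; apply/negP => /(before_find 0).
rewrite nth_iota // => /existsP[].
by exists (in_tuple q); rewrite xq /=.
Qed.

Lemma connect_gdist x y : connect (@adj G) x y ->
  exists p, [/\ path (@adj G) x p, last x p = y & size p = gdist x y].
Proof.
case/connectP => p xp ->; have le_p := gdist_path xp.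
case: (shortenP xp) le_p => q xq uq _ _.
have lt_q : size q < #|G|.
  by have := max_card (mem (x :: q)); rewrite (card_uniqP uq).
have hasw : has (has_walk x (last x q)) (iota 0 #|G|).
  apply/hasP; exists (size q); first by rewrite mem_iota.
  by apply/existsP; exists (in_tuple q); rewrite xq /=.
have := nth_find 0 hasw.
rewrite nth_iota ?add0n -1?[X in _ < X](size_iota 0) -?has_find //.
case/existsP => r /andP[xr /eqP lr]; exists r.
by rewrite size_tuple.
Qed.

End GraphDistance.

(** * Distance in a tree: parity and the four-point condition *)

Section TreeDistance.

Variable G : sgraph.
Hypothesis treeG : tree G.
Implicit Types x y z : G.
Local Notation d := (@gdist G).
Let conn x y : connect (@adj G) x y := treeG.1.2 x y.

Lemma gdist_eq0 x y : (d x y == 0) = (x == y).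
Proof.
apply/eqP/eqP => [d0|->].
  by case: (connect_gdist (conn x y)) => [[|z p]] [_ /= lp]; rewrite d0.
by apply/eqP; rewrite -leqn0; apply: (@gdist_path _ y [::]).
Qed.

Lemma gdist_xx x : d x x = 0.
Proof. by apply/eqP; rewrite gdist_eq0. Qed.

Lemma gdist_sym x y : d x y = d y x.
Proof. by rewrite /gdist (eq_find (has_walk_sym x y)). Qed.

Lemma gdist_tri x y z : d x z <= d x y + d y z.
Proof.
have [p [xp lp <-]] := connect_gdist (conn x y).
have [q [yq lq <-]] := connect_gdist (conn y z).
by rewrite -size_cat -lq -lp -last_cat gdist_path // cat_path xp lp.
Qed.

Lemma gdist_eq1 x y : (d x y == 1) = adj x y.
Proof.
apply/eqP/idP => [d1|xy].
  have [[|z [|? ?]] [/= xp lp]] := connect_gdist (conn x y); rewrite d1 //.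
  by rewrite -lp andbT in xp *.
apply/eqP; rewrite eqn_leq lt0n gdist_eq0 (@gdist_path _ x [:: y]) /= ?xy //.
by apply: contraTneq xy => ->; rewrite adj_irr.
Qed.

Lemma gdist_step x y : x != y -> exists2 z, d x z = 1 & (d z y).+1 = d x y.
Proof.
move=> neq_xy; have [[|z p] [/= xp lp]] := connect_gdist (conn x y).
  by rewrite lp eqxx in neq_xy.
case/andP: xp => xz zp => sz; exists z.
  by apply/eqP; rewrite gdist_eq1.
have := gdist_path zp; rewrite lp.
by have := gdist_tri x z y; move: xz; rewrite -gdist_eq1; lia.
Qed.

(* Two such neighbours of [x] would be joined to [y] by geodesics avoiding [x],
   hence lie with [x] on a cycle. *)
Lemma gdist_toward_uniq x y z z' : adj x z -> adj x z' ->
  d z y <= d x y -> d z' y <= d x y -> z = z'.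
Proof.
move=> xz xz' zy z'y; pose e := relpre val (@adj G) : rel {a | a != x}.
have esym : symmetric e by move=> a b; rewrite /e /= adj_sym.
have [eq_xy | neq_xy] := eqVneq x y.
  by move: zy z'y; rewrite eq_xy (eqP (_ : d y y == 0)) ?gdist_eq0 // !leqn0
    !gdist_eq0 => /eqP -> /eqP ->.
have to_y (a b : {a | a != x}) :
    val b = y -> d (val a) y <= d x y -> connect e a b.
  move=> by_; have [n] := ubnP (d (val a) y); elim: n a => // n IHn a lt_n le_a.
  have [eq_ay|/gdist_step[c ac dc]] := eqVneq (val a) y.
    by rewrite (_ : a = b) //; apply: val_inj; rewrite eq_ay by_.
  have cx : c != x.
    by apply: contra_neq _ (_ : d c y != d x y); [move=> -> | lia].
  apply: (@connect_trans _ _ (Sub c cx)); last by apply: IHn => /=; lia.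
  by apply: connect1; rewrite /e /= -gdist_eq1 ac.
have nx a : adj x a -> a != x by apply: contraTneq => ->; rewrite adj_irr.
have yx : y != x by rewrite eq_sym.
have: connect e (Sub z (nx _ xz)) (Sub z' (nx _ xz')).
  apply: (@connect_trans _ _ (Sub y yx)); first exact: to_y.
  by rewrite (sym_connect_sym esym) to_y.
case/connectP => p0 zp0; case: (shortenP zp0) => p zp up _ /(congr1 val) /= lp.
have {zp0 p0} zp' : path (@adj G) z (map val p).
  by rewrite -[z](SubK {a | a != x} (nx _ xz)) path_map.
have lp' : last z (map val p) = z'.
  by rewrite lp -[in LHS](SubK {a | a != x} (nx _ xz)) last_map.
apply/eqP/negPn/negP => neq_zz'.
have: ucycle (@adj G) (x :: z :: map val p).
  rewrite /ucycle /= xz rcons_path zp' lp' adj_sym xz' /=.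
  have: uniq (map val (Sub z (nx _ xz) :: p)).
    by rewrite map_inj_uniq //; apply: val_inj.
  rewrite /= inE negb_or eq_sym nx //= => ->; rewrite andbT.
  by apply/mapP => -[[a ax] _ /= eq_xa]; rewrite eq_xa eqxx in ax.
move/(treeG.2 _) => /=; rewrite size_map.
case: p {zp up zp' lp} lp' => //= eq_zz'.
by rewrite eq_zz' eqxx in neq_zz'.
Qed.

(** Were the distances equal, [gdist_toward_uniq] would identify [z] with the next vertex on a
    geodesic from [x] to [y], which is closer to [y]. *)
Lemma gdist_neighbour x y z : adj x z ->
  d z y = (d x y).+1 \/ (d z y).+1 = d x y.
Proof.
move=> xz; have xz1 : d x z = 1 by apply/eqP; rewrite gdist_eq1.
have := gdist_tri x z y; have := gdist_tri z x y; have := gdist_sym x z.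
have [eq_d|] := eqVneq (d z y) (d x y); last by lia.
have [eq_xy|/gdist_step[c xc dc]] := eqVneq x y.
  by move: eq_d; rewrite -eq_xy gdist_xx; have := gdist_sym x z; lia.
have: z = c.
  by apply: (@gdist_toward_uniq x y) => //; rewrite -?gdist_eq1 ?xc //; lia.
by move=> eq_zc; rewrite eq_zc in eq_d; lia.
Qed.

(** Moving [y] one step towards [z] changes two of the three distances by exactly 1. *)
Lemma gdist_even x y z : ~~ odd (d x y + d y z + d x z).
Proof.
have [n] := ubnP (d y z); elim: n y => // n IHn y lt_n.
have [<-|/gdist_step[c yc dc]] := eqVneq y z.
  by rewrite gdist_xx; lia.
have := IHn c; have := @gdist_neighbour y x c; rewrite -gdist_eq1 yc.
by rewrite ![d _ x]gdist_sym; lia.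
Qed.

(* A concatenation of geodesics that does not backtrack is a geodesic. *)
Lemma gdist_concat x x' y z : adj x x' -> (d x' y).+1 = d x y ->
  d x' z = (d x z).+1 -> d y z = d y x + d x z.
Proof.
have [n] := ubnP (d x z); elim: n x x' => // n IHn x x' lt_n xx' x'y x'z.
have [<-|/gdist_step[c xc dc]] := eqVneq x z.
  by have := gdist_xx x; lia.
have axc : adj x c by rewrite -gdist_eq1 xc.
have [cy|cy] := gdist_neighbour y axc; last first.
  have: c = x' by apply: (@gdist_toward_uniq x y); lia.
  by move=> eq_c; rewrite eq_c in dc; lia.
have := IHn c x; rewrite adj_sym axc ![d y _]gdist_sym; lia.
Qed.

(** Let [c] follow [x] on a geodesic to [y]. If [c] is nearer to both [z] and [w], induction applies
    to [c]; otherwise [x] lies between [y] and one of them, and the triangle inequality suffices. *)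
Lemma gdist_four x y z w :
  d x y + d z w <= maxn (d x z + d y w) (d x w + d y z).
Proof.
have [n] := ubnP (d x y); elim: n x => // n IHn x lt_n.
have [<-|/gdist_step[c xc dc]] := eqVneq x y.
  have := gdist_tri z x w; have := gdist_xx x; have := gdist_sym x z; lia.
have axc : adj x c by rewrite -gdist_eq1 xc.
have := IHn c; have := gdist_tri z x w; have := gdist_sym x z.
have := gdist_tri y x z; have := gdist_sym x y; have := gdist_sym y z.
have := gdist_sym w x; have := gdist_sym w z; have := gdist_sym w y.
have := @gdist_concat x c y z axc dc; have := @gdist_concat x c y w axc dc.
have := @gdist_concat x c z w axc; have := @gdist_concat x c w z axc.
have := gdist_neighbour z axc; have := gdist_neighbour w axc; lia.
Qed.

Lemma gdist_tree_metric : tree_metric d.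
Proof.
split; [exact: gdist_eq0 | exact: gdist_sym | exact: gdist_tri
  | exact: gdist_even | exact: gdist_step | exact: gdist_four].
Qed.

End TreeDistance.

Section CubeData.

Variable V : finType.
Implicit Types (x y z : V) (C : {set V}) (l : bool * {set V}).

(** * Data computed from the cube alone *)

Section Decoding.

Variable g : rel V.

Definition simplicial x := [forall y, forall z, g x y ==> g x z ==> g y z].
Definition deep_set C :=
  [exists x, exists y,
    [&& ~~ g x y, 2 < #|C| & C == [set z | g x z && g y z]]].
Definition shallow_set C := [exists x, simplicial x && (C == [set z | g x z])].
Definition is_label l := if l.1 then deep_set l.2 else shallow_set l.2.
(* Adjacent or equal. Two distinct shallow vertices are never adjacent. *)
Definition label_adj l l' :=
  if l.1 then if l'.1 then 1 < #|l.2 :&: l'.2| else l.2 \subset l'.2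
  else if l'.1 then l'.2 \subset l.2 else l.2 == l'.2.
(** A key is a non-leaf flag with the label of the vertex or, for a leaf, of its only neighbour. So
    a leaf is joined to the non-leaf carrying its label, and two leaves are never joined. *)
Definition key_adj (k k' : bool * (bool * {set V})) :=
  if k.1 then if k'.1 then label_adj k.2 k'.2 else k.2 == k'.2
  else k'.1 && (k.2 == k'.2).
(* A deep vertex with label [l] has [#|l.2| - 1] neighbours; the labels adjacent
   to [l] account for its non-leaf neighbours and for the vertex itself. *)
Definition key_count (k : bool * (bool * {set V})) : nat :=
  let: (i, l) := k in
  if i then nat_of_bool (is_label l)
  else if l.1 then
    if is_label l then #|l.2| - #|[set l' | is_label l' && label_adj l l']|
    else 0
  else #|[set x | simplicial x && (l.2 == [set z | g x z])]|.

End Decoding.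

Variable d : V -> V -> nat.

Definition internal v :=
  [exists x, exists y, [&& d v x == 1, d v y == 1 & d x y == 2]].
Definition deep v :=
  [exists x, exists y, [&& d v x == 2, d v y == 2 & d x y == 4]].
Definition code v := [set z | d v z <= (if deep v then 1 else 2)].
Definition label v := (deep v, code v).
(** The default [x] would only occur for a vertex without neighbours, which [far] excludes. *)
Definition hub x := if internal x then x else odflt x [pick z | d x z == 1].
Definition key x := (internal x, label (hub x)).

Variable g : rel V.
Hypothesis dT : tree_metric d.
Hypothesis gE : forall x y, g x y = (d x y <= 3).
Variables a0 b0 : V.
Hypothesis far : 3 < d a0 b0.

Lemma dxx x : d x x = 0.
Proof. by apply/eqP; rewrite (tm_eq0 dT). Qed.

Lemma d_eq x y : d x y = 0 -> x = y.
Proof. by move/eqP; rewrite (tm_eq0 dT) => /eqP. Qed.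

Lemma d_triple x y z : exists k,
  d x y = d y x /\ d y z = d z y /\ d x z = d z x /\
  d x y <= d x z + d z y /\ d x z <= d x y + d y z /\ d y z <= d y x + d x z /\
  d x y + d y z + d x z = k + k.
Proof.
exists (d x y + d y z + d x z)./2; rewrite addnn even_halfK ?(tm_even dT) //.
by do !split; rewrite ?(tm_tri dT) // (tm_sym dT).
Qed.

Lemma d_four x y z w :
  [\/ d x y + d z w = d x z + d y w /\ d x w + d y z <= d x y + d z w,
      d x y + d z w = d x w + d y z /\ d x z + d y w <= d x y + d z w |
      d x z + d y w = d x w + d y z /\ d x y + d z w <= d x z + d y w].
Proof.
have := tm_four dT x y z w; have := tm_four dT x z y w.
have := tm_four dT x w y z.
rewrite ![d w _](tm_sym dT) [d z y](tm_sym dT) => h1 h2 h3.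
have [?|?] := eqVneq (d x y + d z w) (d x z + d y w).
  by constructor 1; lia.
have [?|?] := eqVneq (d x y + d z w) (d x w + d y z).
  by constructor 2; lia.
by constructor 3; lia.
Qed.

Ltac triple x y z :=
  let k := fresh in have [k [? [? [? [? [? [? ?]]]]]]] := d_triple x y z.
Ltac quad x y z w :=
  triple x y z; triple x y w; triple x z w; triple y z w;
  let h1 := fresh in let h2 := fresh in
  have [[h1 h2]|[h1 h2]|[h1 h2]] := d_four x y z w.

Lemma geodesic x y k : k <= d x y -> exists2 z, d x z = k & d z y = d x y - k.
Proof.
elim: k x => [|k IHk] x lek; first by exists x; rewrite ?dxx ?subn0.
have [eq_xy|/(tm_step dT)[c xc cy]] := eqVneq x y.
  by move: lek; rewrite eq_xy dxx.
have [|z cz zy] := IHk c; first by lia.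
exists z; last by lia.
by triple x c z; triple x y z; lia.
Qed.

(** * Deep vertices, shallow vertices and leaves *)

Lemma internalP v :
  reflect (exists x y, [/\ d v x = 1, d v y = 1 & d x y = 2]) (internal v).
Proof.
apply: (iffP existsP) => -[x].
  by case/existsP=> y /and3P[/eqP ? /eqP ? /eqP ?]; exists x, y.
by case=> y [vx vy xy]; exists x; apply/existsP; exists y; rewrite vx vy xy.
Qed.

Lemma deepP v :
  reflect (exists x y, [/\ d v x = 2, d v y = 2 & d x y = 4]) (deep v).
Proof.
apply: (iffP existsP) => -[x].
  by case/existsP=> y /and3P[/eqP ? /eqP ? /eqP ?]; exists x, y.
by case=> y [vx vy xy]; exists x; apply/existsP; exists y; rewrite vx vy xy.
Qed.

Lemma deep_internal v : deep v -> internal v.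
Proof.
case/deepP=> x [y [vx vy xy]]; apply/internalP.
have [|a va ax] := @geodesic v x 1; first by lia.
have [|b vb yb] := @geodesic v y 1; first by lia.
by exists a, b; split=> //; quad v a b x; triple b x y; lia.
Qed.

(** Some vertex is at distance at least 3 from [u], else [a0] and [b0] would make [u] deep; [v] is
    the neighbour of [u] on the way to it. Every other branch at [u] is a single leaf, since
    vertices at distance 2 in two branches would make [u] deep. *)
Lemma shallowP u : internal u -> ~~ deep u -> exists v t,
  [/\ deep v, d u v = 1, d u t = 1, d t v = 2 &
      forall z, 1 < d u z -> (d v z).+1 = d u z].
Proof.
case/internalP=> p [q [up uq pq]] nd.
have [y uy]: exists y, 2 < d u y.
  have [ua|ua] := ltnP 2 (d u a0); first by exists a0.
  have [ub|ub] := ltnP 2 (d u b0); first by exists b0.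
  by case/deepP: nd; exists a0, b0; move: far; triple a0 u b0; split; lia.
have [z uz _] := geodesic uy.
have [|v uv vz] := @geodesic u z 1; first by lia.
have [t ut tv]: exists2 t, d u t = 1 & d t v = 2.
  have [eq_pv|neq_pv] := eqVneq p v.
    by exists q; rewrite // -eq_pv (tm_sym dT).
  by exists p => //; move: neq_pv; rewrite -(tm_eq0 dT); triple u p v; lia.
have [|w uw wz] := @geodesic u z 2; first by lia.
exists v, t; split=> //.
  by apply/deepP; exists t, z; split; quad u v t z; lia.
move=> s us; apply/eqP/negPn/negP => /eqP vs.
have [r ur rs] := geodesic us.
have vr: d v r = 3 by triple u v s; quad u v r s; lia.
have vw: d v w = 1 by quad u v w z; lia.
by case/deepP: nd; exists w, r; split => //; quad u v w r; lia.
Qed.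

Lemma exists_far x : exists y, 1 < d x y.
Proof.
have [xa|xa] := ltnP 1 (d x a0); first by exists a0.
by exists b0; move: far; triple a0 x b0; lia.
Qed.

Lemma hub_internal x : internal x -> hub x = x.
Proof. by rewrite /hub => ->. Qed.

(** Paths leaving a leaf use its only edge; the other end is no leaf because some vertex is at
    distance at least 2 from [x]. *)
Lemma hub_leaf x : ~~ internal x ->
  [/\ internal (hub x), d x (hub x) = 1 &
      forall z, z != x -> (d (hub x) z).+1 = d x z].
Proof.
move=> nix; have [y xy] := exists_far x.
have [|b xb by_] := @geodesic x y 1; first by lia.
have xh: d x (hub x) = 1.
  rewrite /hub (negPf nix); case: pickP => [z /eqP //|/(_ b)].
  by rewrite xb.
have hz z : z != x -> (d (hub x) z).+1 = d x z.
  move=> zx; apply/eqP/negPn/negP=> /eqP hz.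
  have [c xc cz] := tm_step dT (introN eqP (nesym (elimN eqP zx))).
  case/internalP: nix; exists (hub x), c; split=> //.
  by quad x (hub x) c z; lia.
split=> //; apply/internalP; have [r xr ry] := geodesic xy.
exists x, r; rewrite (tm_sym dT) xh xr; split=> //.
by have := hz r; rewrite -(tm_eq0 dT); triple x (hub x) r; lia.
Qed.

Lemma internal_hub x : internal (hub x).
Proof.
have [ix|/hub_leaf[]//] := boolP (internal x).
by rewrite hub_internal.
Qed.

Lemma hub_eq x u : ~~ internal x -> internal u -> (hub x == u) = (d x u <= 1).
Proof.
move=> nix iu; have [_ xh hz] := hub_leaf nix.
apply/eqP/idP => [<-|xu]; first by rewrite xh.
have ux: u != x by apply: contraNneq nix => <-.
by apply: d_eq; have := hz u ux; lia.
Qed.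

(** * Recognising balls in the cube *)

Lemma deep_cap v : deep v ->
  exists x y, ~~ g x y /\ code v = [set z | g x z && g y z].
Proof.
move=> dv; rewrite /code dv; case/deepP: dv => x [y [vx vy xy]].
exists x, y; rewrite gE xy; split=> //; apply/setP=> z; rewrite !inE !gE.
(* By the four-point condition, [d v z + 4 <= 2 + maxn (d x z) (d y z)]. *)
by quad v x y z; lia.
Qed.

Lemma internal_card v : internal v -> deep v -> 2 < #|code v|.
Proof.
case/internalP=> p [q [vp vq pq]] dv; rewrite /code dv.
have <-: #|[set v; p; q]| = 3.
  rewrite setUC cardsU1 cards2 !inE negb_or -!(tm_eq0 dT).
  by rewrite vp ![d q _](tm_sym dT) vq pq.
apply/subset_leq_card/subsetP=> z; rewrite !inE.
by case/orP=> [/orP[]|] /eqP->; rewrite ?dxx ?vp ?vq.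
Qed.

(** At distance 4 the intersection is the ball around the midpoint; at larger distance it lies
    within two consecutive vertices of a geodesic. *)
Lemma cap_deep x y : ~~ g x y -> 2 < #|[set z | g x z && g y z]| ->
  exists2 v, deep v & code v = [set z | g x z && g y z].
Proof.
rewrite gE -ltnNge => xy.
have [|b xb b_y] := @geodesic x y 2; first by lia.
have [|c bc c_y] := @geodesic b y 1; first by lia.
have [xy4 _|xy4] := eqVneq (d x y) 4.
  have db: deep b by apply/deepP; exists x, y; split=> //; triple x b y; lia.
  exists b; rewrite // /code db; apply/setP=> z; rewrite !inE !gE.
  by quad b x y z; triple x b y; lia.
have/subset_leq_card: [set z | g x z && g y z] \subset [set b; c].
  apply/subsetP=> z; rewrite !inE !gE -!(tm_eq0 dT) => /andP[xz yz].
  have xc: d x c = 3 by triple x b c; triple x c y; lia.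
  have zb: d z b <= 1 by quad x y b z; lia.
  have zc: d z c <= 1 by quad x y c z; lia.
  by triple b z c; lia.
by rewrite cards2; case: eqP => _; lia.
Qed.

Lemma deep_setP C : reflect (exists2 v, deep v & code v = C) (deep_set g C).
Proof.
apply: (iffP existsP) => [[x /existsP[y /and3P[xy C2 /eqP eqC]]]|[v dv <-]].
  by rewrite eqC in C2 *; apply: cap_deep.
have [x [y [xy eqC]]] := deep_cap dv; exists x; apply/existsP; exists y.
by rewrite xy eqC eqxx -eqC internal_card ?deep_internal.
Qed.

(** Paths from [x] pass through its hub. The ball of radius 2 there is a clique because all vertices
    at distance 2 from the hub are adjacent to the same neighbour [v] of it. *)
Lemma shallow_ball x : ~~ internal x -> ~~ deep (hub x) ->
  simplicial g x && (code (hub x) == [set z | g x z]).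
Proof.
move=> nix nd; have [ih xh hz] := hub_leaf nix.
have [v [t [_ hv _ _ vz]]] := shallowP ih nd.
have ball z : g x z = (d (hub x) z <= 2).
  rewrite gE; have [->|zx] := eqVneq z x; last by have := hz z zx; lia.
  by rewrite dxx (tm_sym dT) xh.
apply/andP; split; last first.
  by rewrite /code (negPf nd); apply/eqP/setP=> z; rewrite !inE ball.
apply/forallP=> y; apply/forallP=> z; rewrite !ball.
apply/implyP=> hy; apply/implyP=> hz'.
rewrite gE; have := vz y; have := vz z.
triple (hub x) y z; triple v y z.
by triple (hub x) v y; triple (hub x) v z; lia.
Qed.

(** Some geodesic from [x] has length at least 4; a neighbour of [x] off it would be at distance 4
    from its vertex [c]. If the hub were deep, the ends of a path of length 4 centred there would be
    within 3 of [x]. *)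
Lemma simplicial_leaf x : simplicial g x -> ~~ internal x /\ ~~ deep (hub x).
Proof.
move=> sx.
have sxP y z : d x y <= 3 -> d x z <= 3 -> d y z <= 3.
  have/forallP/(_ y)/forallP/(_ z) := sx.
  by rewrite !gE => /implyP xy /xy/implyP.
have [y xy]: exists y, 3 < d x y.
  have [xa|xa] := ltnP 3 (d x a0); first by exists a0.
  have [xb|xb] := ltnP 3 (d x b0); first by exists b0.
  by have := sxP _ _ xa xb; rewrite leqNgt far.
have [|a xa ay] := @geodesic x y 1; first by lia.
have [|c xc cy] := @geodesic x y 3; first by lia.
have nix: ~~ internal x.
  have ac: d a c = 2 by quad x a c y; lia.
  have pa p: d x p = 1 -> d p a = 0 by have := sxP p c; quad x p c a; lia.
  apply/internalP=> -[p [q [/pa pa0 /pa qa0]]].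
  by triple p a q; lia.
split=> //; have [ih xh hz] := hub_leaf nix.
apply/deepP=> -[p [q [hp hq pq]]].
have neq z : d (hub x) z = 2 -> z != x.
  by apply: contra_eq_neq => ->; rewrite (tm_sym dT) xh.
have := hz p (neq p hp); have := hz q (neq q hq); have := sxP p q; lia.
Qed.

Lemma shallow_leaf u : internal u -> ~~ deep u ->
  exists2 t, ~~ internal t & hub t = u.
Proof.
move=> iu nd; have [v [t [_ uv ut tv vz]]] := shallowP iu nd.
have nit: ~~ internal t.
  have pu p: d t p = 1 -> d p u = 0 by have := vz p; quad u v t p; lia.
  apply/internalP=> -[p [q [/pu pu0 /pu qu0]]].
  by triple p u q; lia.
by exists t => //; apply/eqP; rewrite hub_eq // (tm_sym dT) ut.
Qed.

Lemma shallow_setP C :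
  reflect (exists2 v, internal v && ~~ deep v & code v = C) (shallow_set g C).
Proof.
apply: (iffP existsP) => [[x /andP[sx /eqP->]]|[u /andP[iu nd] <-]].
  have [nix nd] := simplicial_leaf sx.
  exists (hub x); first by rewrite internal_hub.
  by case/andP: (shallow_ball nix nd) => _ /eqP.
have [t nit eq_u] := shallow_leaf iu nd.
by exists t; rewrite -eq_u in nd *; apply: shallow_ball.
Qed.

(** * Labels determine the non-leaves and their adjacency *)

Lemma is_labelP l :
  reflect (exists2 v, internal v & label v = l) (is_label g l).
Proof.
case: l => -[] C; rewrite /is_label /=.
  apply: (iffP (deep_setP C)) => -[v dv].
    by move=> <-; exists v; rewrite ?deep_internal // /label dv.
  by case=> dv' <-; exists v.
apply: (iffP (shallow_setP C)) => -[v iv].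
  by case/andP: iv => iv nd <-; exists v; rewrite // /label (negPf nd).
by case=> nd <-; exists v; rewrite // iv nd.
Qed.

(** If [u] and [v] were adjacent, [u'] would be at distance 2 from [v], hence next to [v']; but
    [u'], [u], [v], [v'] form a path of length 3. *)
Lemma shallow_adj u v : internal u -> ~~ deep u -> internal v -> ~~ deep v ->
  d u v <= 1 -> u = v.
Proof.
move=> iu ndu iv ndv uv; apply: d_eq.
have [u' [_ [du' uu' _ _ _]]] := shallowP iu ndu.
have [v' [_ [dv' vv' _ _ vz]]] := shallowP iv ndv.
have: u' != v by apply: contraNneq ndv => <-.
have: v' != u by apply: contraNneq ndu => <-.
rewrite -!(tm_eq0 dT) => neq_uv' neq_vu'.
apply/eqP/negPn/negP => neq_uv; have := vz u'.
by quad u v u' v'; lia.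
Qed.

Lemma label_inj u v : internal u -> internal v -> label u = label v -> u = v.
Proof.
move=> iu iv [du /setP cuv]; pose r := if deep v then 1 else 2.
have codeE z : (d u z <= r) = (d v z <= r).
  by have := cuv z; rewrite !inE du.
rewrite {}/r in codeE; case dv: (deep v) in codeE du.
  have := codeE u; have := codeE v; rewrite !dxx => uv vu.
  case/internalP: iu => p [q [up uq pq]].
  have := codeE p; have := codeE q.
  by move=> eq eq'; apply: d_eq; quad u v p q; lia.
have ndu : ~~ deep u by rewrite du.
have ndv : ~~ deep v by rewrite dv.
have [u' [t [_ uu' ut tu' uz]]] := shallowP iu ndu.
(* At distance 2 from [u], [v] would lie behind [u'] and so at distance 3 from [t], which is in the
   ball of [u]. *)
apply: shallow_adj => //; have := codeE v; have := codeE t; have := uz v.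
by rewrite dxx; quad u v t u'; lia.
Qed.

(** Unit balls around adjacent vertices share both centres, and at distance 2 only the midpoint. A
    non-leaf [w] has a neighbour on the side away from [z], which bounds [d w z] once the ball of
    [w] fits in that of [z]. *)
Lemma label_adjP u v : internal u -> internal v ->
  label_adj (label u) (label v) = (d u v <= 1).
Proof.
have deep_sub w z : internal w -> deep w -> internal z -> ~~ deep z ->
    (code w \subset code z) = (d w z <= 1).
  move=> iw dw iz ndz; have [z' [t [_ zz' zt tz' zfar]]] := shallowP iz ndz.
  apply/subsetP/idP => [sub_wz|wz x]; last first.
    rewrite !inE dw (negPf ndz); have [eq_wz|] := eqVneq w z.
      by rewrite eq_wz; lia.
    by triple w z x; lia.
  case/internalP: iw => p [q [wp wq pq]].
  have inz x : d w x <= 1 -> d z x <= 2.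
    by move=> wx; have := sub_wz x; rewrite !inE dw (negPf ndz); apply.
  have := inz w; have := inz p; have := inz q; rewrite dxx.
  by quad w z p q; lia.
move=> iu iv; rewrite /label_adj /=.
case du: (deep u); case dv: (deep v).
- rewrite /code du dv; have [uv|uv] := leqP (d u v) 1.
    have [eq_uv|neq_uv] := eqVneq u v.
      have := internal_card iv dv; rewrite /code dv eq_uv setIid.
      by move=> /ltnW ->.
    have <-: #|[set u; v]| = 2 by rewrite cards2 neq_uv.
    apply/subset_leq_card/subsetP=> z; rewrite !inE => /orP[]/eqP->.
      by rewrite dxx (tm_sym dT).
    by rewrite dxx uv.
  apply/negbTE; rewrite -leqNgt.
  have [|m um mv] := @geodesic u v 1; first by lia.
  rewrite -[leqRHS](cards1 m); apply/subset_leq_card/subsetP=> z.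
  by rewrite !inE -(tm_eq0 dT); quad u v m z; lia.
- by rewrite deep_sub // dv.
- by rewrite deep_sub // ?du // (tm_sym dT).
apply/eqP/idP => [eq_c|uv].
  by rewrite (label_inj iu iv) ?dxx // /label du dv eq_c.
by congr code; apply: shallow_adj; rewrite ?du ?dv.
Qed.

Lemma keyE x y : x != y -> (d x y <= 1) = key_adj (key x) (key y).
Proof.
move=> neq_xy; rewrite /key_adj /=.
have eq_label u v : internal u -> internal v -> (label u == label v) = (u == v).
  by move=> iu iv; apply/eqP/eqP => [/label_inj-> //|->].
case ix: (internal x); case iy: (internal y).
- by rewrite !hub_internal // label_adjP.
- rewrite (hub_internal ix) eq_label ?internal_hub // eq_sym hub_eq ?iy //.
  by rewrite (tm_sym dT).
- by rewrite (hub_internal iy) eq_label ?internal_hub // hub_eq ?ix.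
have [|ih xh hz] := @hub_leaf x; first by rewrite ix.
apply/negP=> xy; have := hz y; rewrite eq_sym neq_xy => /(_ isT) h.
have: hub x = y by apply: d_eq; lia.
by move=> eq_h; rewrite eq_h iy in ih.
Qed.

Lemma card_key k : #|[set x | key x == k]| = key_count g k.
Proof.
case: k => i l; rewrite /key_count; case: i.
  have [[u iu <-]|nl] := is_labelP l.
    rewrite /= -[RHS](cards1 u); apply: eq_card => x.
    rewrite !inE /key xpair_eqE eqb_id.
    apply/andP/eqP=> [[ix]|->]; last by rewrite hub_internal.
    by rewrite hub_internal // => /eqP/label_inj->.
  apply: eq_card0 => x; rewrite !inE; apply/eqP=> -[ix lx].
  by case: nl; exists x; rewrite // -lx hub_internal.
case: l => -[] C /=; last first.
  apply: eq_card => x; rewrite !inE; apply/eqP/andP=> [[nix nd <-]|[sx /eqP->]].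
    by apply/andP/shallow_ball; rewrite ?nix ?nd.
  have [nix nd] := simplicial_leaf sx.
  rewrite /key (negPf nix) /label (negPf nd).
  by case/andP: (shallow_ball nix nd) => _ /eqP->.
have [[v iv eq_l]|nl] := is_labelP (true, C); last first.
  apply: eq_card0 => x; rewrite !inE; apply/eqP=> -[ix lx cx].
  by case: nl; exists (hub x); rewrite ?internal_hub // /label lx cx.
have [dv eq_C] : deep v /\ code v = C by case: eq_l.
have ->: #|[set l' | is_label g l' && label_adj (true, C) l']| =
         #|C :&: [set x | internal x]|.
  rewrite -(card_in_imset (f := label)); last first.
    by move=> x y; rewrite !inE => /andP[_ ix] /andP[_ iy]; apply: label_inj.
  apply: eq_card => l; rewrite inE -eq_l; apply/andP/imsetP.
    case=> /is_labelP[u iu <-]; rewrite label_adjP // => uv.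
    by exists u; rewrite // inE -eq_C !inE dv uv.
  case=> u; rewrite inE -eq_C !inE dv => /andP[uv iu] ->; split.
    by apply/is_labelP; exists u.
  by rewrite label_adjP.
(* Removing the non-leaves from the ball [C] leaves the leaves attached to [v]. *)
rewrite -cardsD; apply: eq_card => x.
rewrite !inE /key -eq_l xpair_eqE eqbF_neg.
have [//|nix] := boolP (internal x).
rewrite /= -eq_C inE dv (tm_sym dT) -hub_eq //.
by apply/eqP/eqP=> [/label_inj->//|->//]; rewrite internal_hub.
Qed.

End CubeData.

(** * Matching vertices with equal keys *)

Lemma fiber_inj (V : finType) (K : eqType) (k k' : V -> K) :
  (forall c, #|[set x | k x == c]| = #|[set x | k' x == c]|) ->
  exists2 h : V -> V, injective h & forall x, k' (h x) = k x.
Proof.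
move=> eq_card_fib.
pose fib (q : V -> K) c := enum [set x | q x == c].
(* The n-th element of a fibre of [k] goes to the n-th of the same fibre of [k']. *)
pose h x := nth x (fib k' (k x)) (index x (fib k (k x))).
have idx x : index x (fib k (k x)) < size (fib k' (k x)).
  by rewrite -cardE -eq_card_fib cardE index_mem mem_enum inE.
have hk x : k' (h x) = k x.
  by have := mem_nth x (idx x); rewrite mem_enum inE => /eqP.
exists h => // x y eq_h; have eq_k : k x = k y by rewrite -!hk eq_h.
move: eq_h (idx x); rewrite /h eq_k => eq_h idx_x.
move/eqP: eq_h; rewrite (set_nth_default x y) // nth_uniq ?enum_uniq //.
move/eqP/(congr1 (nth x (fib k (k y)))).
by rewrite !nth_index // mem_enum inE ?eq_k.
Qed.

Lemma tree_metric_preim (V W : finType) (f : V -> W) (d : W -> W -> nat) :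
  bijective f -> tree_metric d -> tree_metric (fun x y => d (f x) (f y)).
Proof.
case=> f' fK f'K [eq0 sym tri even step four]; split=> // x y.
  by rewrite eq0 (can_eq fK).
rewrite -(can_eq fK) => /step[z]; rewrite -(f'K z) => xz zy.
by exists (f' z).
Qed.

Lemma power_adj_tree k (G : sgraph) (x y : G) : tree G ->
  @adj (power k G) x y = (x != y) && (gdist x y <= k).
Proof. by case=> -[_ conn] _; rewrite /= /power_adj conn. Qed.

Lemma adj_gdist_le1 (G : sgraph) (x y : G) : tree G ->
  adj x y = (x != y) && (gdist x y <= 1).
Proof.
move=> treeG; rewrite -(gdist_eq1 treeG) -(gdist_eq0 treeG).
by case: gdist => [|[]].
Qed.

Theorem theorem3p2 (T1 T2 : sgraph) (tree1 : tree T1) (tree2 : tree T2)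
  (iso_cubes : isomorphic (power 3 T1) (power 3 T2))
  (not_complete : ~ complete (power 3 T1)) :
  isomorphic T1 T2.
Proof.
case: iso_cubes => f bij_f mono_f; change (T1 -> T2) in f.
pose d1 := @gdist T1; pose d2 (x y : T1) := gdist (f x) (f y).
pose g : rel T1 := fun x y => d1 x y <= 3.
have d1T : tree_metric d1 := gdist_tree_metric tree1.
have d2T : tree_metric d2 := tree_metric_preim bij_f (gdist_tree_metric tree2).
have gE1 x y : g x y = (d1 x y <= 3) by [].
have gE2 x y : g x y = (d2 x y <= 3).
  have := mono_f x y; rewrite !power_adj_tree // (bij_eq bij_f) /g /d1 /d2.
  have [->|//] := eqVneq x y.
  by rewrite (gdist_xx tree1) (gdist_xx tree2).
have [a [b far]]: exists a b, 3 < d1 a b.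
  have [/existsP[a /existsP[b ab]]|near] :=
    boolP [exists a, exists b, 3 < d1 a b].
    by exists a, b.
  case: not_complete => x y neq_xy; rewrite power_adj_tree // neq_xy /=.
  apply: contraR near; rewrite -ltnNge => xy.
  by apply/existsP; exists x; apply/existsP; exists y.
have far2 : 3 < d2 a b by rewrite ltnNge -gE2 -ltnNge.
(* Key counts depend on [g] only, so both metrics have equally large key fibres. *)
have [h inj_h hk] : exists2 h, injective h & forall x, key d2 (h x) = key d1 x.
  apply: fiber_inj => k.
  by rewrite (card_key d1T gE1 far) (card_key d2T gE2 far2).
exists (f \o h) => [|x y]; first by apply: bij_comp bij_f (injF_bij inj_h).
rewrite /= !adj_gdist_le1 // (bij_eq bij_f) (inj_eq inj_h).
have [//|neq_xy] := eqVneq x y; rewrite -/(d1 x y) -/(d2 (h x) (h y)) /=.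
by rewrite (keyE d1T far) // (keyE d2T far2) ?(inj_eq inj_h) // !hk.
Qed.
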